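(* Let $\mathcal{H}$ be a countably generated Hilbert $\mathcal{A}$-module over a unital $C^*$-algebra $\mathcal{A}$. Let $\xi$ be a positive real number and let $\{l_k\}_{k=1}^{\infty}$ be a sequence of real numbers greater than $\xi$ such that $\lim_{k\to\infty}l_k=\xi$. If $\{e_k\}_{k=1}^{\infty}$ is any orthonormal basis of $\mathcal{H}$, then $\{l_k^{1/2}e_k\}_{k=1}^{\infty}$ is a compact-tight frame for $\mathcal{H}$ with (lower and upper) frame bounds $\xi$ and $\sup_kl_k$.
   Context: Hilbert $\mathcal{A}$-modules are left modules with an $\mathcal{A}$-valued inner product $\langle\cdot,\cdot\rangle$ that is $\mathcal{A}$-linear in the first variable and satisfies $\langle x,y\rangle=\langle y,x\rangle^*$; the norm is $\|x\|=\|\langle x,x\rangle\|^{1/2}$. Inequalities between elements of $\mathcal{A}$ are in the order of self-adjoint elements of $\mathcal{A}$, and series are understood to converge in norm. A sequence $\{f_k\}_{k=1}^\infty$ in $\mathcal{H}$ is a frame with lower bound $A>0$ and upper bound $B>0$ if $A\langle f,f\rangle\le\sum_{k}\langle f,f_k\rangle\langle f_k,f\rangle\le B\langle f,f\rangle$ for all $f\in\mathcal{H}$; its frame operator is $Sf=\sum_k\langle f,f_k\rangle f_k$. An orthonormal basis $\{e_k\}_{k=1}^\infty$ satisfies $\langle e_j,e_k\rangle=\delta_{jk}1_{\mathcal{A}}$ and $f=\sum_k\langle f,e_k\rangle e_k$ for all $f\in\mathcal{H}$. Compact operators on $\mathcal{H}$ are the elements of the norm closure of the linear span of the operators $f\mapsto\langle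 f,x\rangle y$, $x,y\in\mathcal{H}$. A frame is compact-tight if its frame operator has the form $S=\mathcal{K}+\xi' I$ with $\mathcal{K}$ a compact operator and $\xi'$ a real scalar; $I$ is the identity operator. *)

(* Defs.v *)
From HB Require Import structures.
From mathcomp Require Import all_boot all_order all_algebra.
From mathcomp Require Import complex.
From mathcomp Require Import all_classical all_reals all_analysis.

Set Implicit Arguments.
Unset Strict Implicit.
Unset Printing Implicit Defensive.

Import Order.TTheory GRing.Theory Num.Theory.
Import numFieldNormedType.Exports.

Local Open Scope classical_set_scope.
Local Open Scope ring_scope.
Local Open Scope complex_scope.

(* Unital C*-algebras over R[i].  Norms over the field R[i] take their values
   in R[i], where 0 <= z means that z is real and nonnegative.  A structure
   joining the ring and the normed module hierarchies would be missing below
   numDomainType, so the product is part of the mixin, and the ring and algebra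
   structures are derived from it afterwards. *)
HB.mixin Record isCStarAlgebra (R : realType) A
    & CompleteNormedModule R[i] A := {
  cstar_one : A;
  cstar_mul : A -> A -> A;
  cstar_mulA : associative cstar_mul;
  cstar_mul1 : left_id cstar_one cstar_mul;
  cstar_mulr1 : right_id cstar_one cstar_mul;
  cstar_mulDl : left_distributive cstar_mul +%R;
  cstar_mulDr : right_distributive cstar_mul +%R;
  cstar_one_neq0 : cstar_one != 0;
  cstar_scaleAl : forall (c : R[i]) (a b : A),
    c *: cstar_mul a b = cstar_mul (c *: a) b;
  cstar_scaleAr : forall (c : R[i]) (a b : A),
    c *: cstar_mul a b = cstar_mul a (c *: b);
  star : A -> A;
  starD : forall a b : A, star (a + b) = star a + star b;
  starZ : forall (c : R[i]) (a : A), star (c *: a) = Num.conj c *: star a;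
  starM : forall a b : A, star (cstar_mul a b) = cstar_mul (star b) (star a);
  starK : involutive star;
  normM_le : forall a b : A, `|cstar_mul a b| <= `|a| * `|b|;
  norm_starM : forall a : A, `|cstar_mul (star a) a| = `|a| ^+ 2
}.

#[short(type="cstarAlgType")]
HB.structure Definition CStarAlgebra (R : realType) :=
  {A of isCStarAlgebra R A & CompleteNormedModule R[i] A}.

HB.instance Definition _ (R : realType) (A : cstarAlgType R) :=
  GRing.Zmodule_isNzRing.Build A (@cstar_mulA R A) (@cstar_mul1 R A)
    (@cstar_mulr1 R A) (@cstar_mulDl R A) (@cstar_mulDr R A)
    (@cstar_one_neq0 R A).

HB.instance Definition _ (R : realType) (A : cstarAlgType R) :=
  GRing.Lmodule_isLalgebra.Build R[i] A (@cstar_scaleAl R A).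

#[non_forgetful_inheritance]
HB.instance Definition _ (R : realType) (A : cstarAlgType R) :=
  GRing.Lalgebra_isAlgebra.Build R[i] A (@cstar_scaleAr R A).

Section CStarOrder.
Context {R : realType} {A : cstarAlgType R}.
Implicit Types a b : A.

Definition selfadjoint a : Prop := star a = a.

Definition invertible a : Prop := exists b, a * b = 1 /\ b * a = 1.

Definition spectrum a : set R[i] := [set z | ~ invertible (z%:A - a)].

Definition cstar_pos a : Prop :=
  selfadjoint a /\ forall z, spectrum a z -> 0 <= z.

Definition cstar_le a b : Prop :=
  [/\ selfadjoint a, selfadjoint b & cstar_pos (b - a)].

End CStarOrder.

(* Left Hilbert modules.  The notation *: is kept for complex scalars; the
   action of A is [act], and c *: x is the action of c%:A = c *: 1.  The norm
   is |x| = |<x, x>| ^ (1/2), so that <x, x> = 0 only if x = 0, and H is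
   complete for it. *)
HB.mixin Record isHilbertModule (R : realType) (A : cstarAlgType R) H
    & CompleteNormedModule R[i] H := {
  act : A -> H -> H;
  actDl : forall (a b : A) (x : H), act (a + b) x = act a x + act b x;
  actDr : forall (a : A) (x y : H), act a (x + y) = act a x + act a y;
  actA : forall (a b : A) (x : H), act (a * b) x = act a (act b x);
  act_scalar : forall (c : R[i]) (x : H), act c%:A x = c *: x;
  inner : H -> H -> A;
  innerDl : forall x y z : H, inner (x + y) z = inner x z + inner y z;
  innerZl : forall (a : A) (x y : H), inner (act a x) y = a * inner x y;
  inner_star : forall x y : H, inner x y = star (inner y x);
  inner_pos : forall x : H, cstar_pos (inner x x);
  norm_inner : forall x : H, `|x| ^+ 2 = `|inner x x|
}.

#[short(type="hilbertModType")]
HB.structure Definition HilbertModule (R : realType) (A : cstarAlgType R) :=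
  {H of isHilbertModule R A H & CompleteNormedModule R[i] H}.

Section HilbertModules.
Context {R : realType} {A : cstarAlgType R}.
Variable H : hilbertModType A.

Definition module_span (g : nat -> H) : set H :=
  [set x | exists (n : nat) (a : nat -> A), x = \sum_(k < n) act (a k) (g k)].

Definition countably_generated : Prop :=
  exists g : nat -> H, closure (module_span g) = setT.

Definition orthonormal_basis (e : nat -> H) : Prop :=
  (forall j k, inner (e j) (e k) = (j == k)%:R) /\
  (forall f : H, series (fun k => act (inner f (e k)) (e k)) @ \oo --> f).

Definition frame_with_bounds (F : nat -> H) (a b : R) : Prop :=
  [/\ 0 < a, 0 < b &
   forall f : H,
     let s := series (fun k => inner f (F k) * inner (F k) f) in
     [/\ cvgn s,
         cstar_le (a%:C *: inner f f) (limn s) &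
         cstar_le (limn s) (b%:C *: inner f f)]].

Definition frame (F : nat -> H) : Prop :=
  exists a b : R, frame_with_bounds F a b.

(* [limn] is only meaningful for a convergent sequence: convergence is asserted
   wherever [frame_operator] is used. *)
Definition frame_operator (F : nat -> H) (f : H) : H :=
  limn (series (fun k => act (inner f (F k)) (F k))).

Definition rank_one (x y : H) (f : H) : H := act (inner f x) y.

Definition finite_rank (T : H -> H) : Prop :=
  exists (n : nat) (c : 'I_n -> R[i]) (x y : 'I_n -> H),
    forall f, T f = \sum_(i < n) c i *: rank_one (x i) (y i) f.

(* The last inequality says that the operator norm of K - T is at most eps;
   it forces K to be bounded and A-linear, as the operators T are. *)
Definition compact_operator (K : H -> H) : Prop :=
  forall eps : R, 0 < eps ->
    exists T, finite_rank T /\ forall f, `|K f - T f| <= eps%:C * `|f|.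

Definition compact_tight_frame (F : nat -> H) : Prop :=
  [/\ frame F,
      forall f : H, cvgn (series (fun k => act (inner f (F k)) (F k))) &
      exists (K : H -> H) (xi' : R), compact_operator K /\
        forall f, frame_operator F f = K f + xi'%:C *: f].

End HilbertModules.

(* Main.v *)
(** The vectors t_k = <f, e_k> e_k are pairwise orthogonal, so the norm of a
    finite sum of u_k t_k depends on the scalars u_k only through |u_k|.  A real
    number in [-1, 1] is the mean of two conjugate numbers of modulus 1, hence
    |sum m_k t_k| <= M |sum t_k| whenever all |m_k| <= M, without any positivity
    argument in A.  So every bounded real multiplier m defines an operator
    f |-> sum m_k t_k of norm at most sup |m_k|, and this operator is a norm
    limit of its finite-rank truncations when m_k tends to 0.  The frame
    operator is the multiplier l, which is xi I plus the multiplier l - xi.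
    For m >= 0, the series of m_k <t_k, t_k> converges to <g, g>, where g is the
    sum of the sqrt(m_k) t_k, and is therefore positive; taking m = l - a and
    m = b - l gives the inequalities for the frame bounds a and b. *)

Require Import Defs.
From HB Require Import structures.
From mathcomp Require Import all_boot all_order all_algebra.
From mathcomp Require Import complex ring lra.
From mathcomp Require Import all_classical all_reals all_analysis.

Import Order.TTheory GRing.Theory Num.Theory.
Import numFieldNormedType.Exports.

Local Open Scope classical_set_scope.
Local Open Scope ring_scope.
Local Open Scope complex_scope.

(** * Passage to the limit in normed modules *)

Lemma cvg_quadratic_bound (K : numFieldType) (V W : normedModType K)
    (u : nat -> V) (x : V) (w : nat -> W) (y : W) (C : K) : 0 <= C ->
  (forall n, `|w n - y| <= `|u n - x| * C + `|u n - x| ^+ 2) ->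
  u @ \oo --> x -> w @ \oo --> y.
Proof.
move=> C0 wu ux; apply/cvgrPdist_lt => eps eps0.
have d0 : `|u n - x| @[n --> \oo] --> (0 : K).
  rewrite -(normr0 V); apply: cvg_norm; rewrite -(subrr x).
  by apply: cvgB => //; apply: cvg_cst.
have lim0 : `|u n - x| * C + `|u n - x| * `|u n - x| @[n --> \oo] --> (0 : K).
  rewrite -(addr0 (0 : K)); apply: cvgD.
    by rewrite -(mul0r C); apply: cvgM => //; apply: cvg_cst.
  by rewrite -[X in _ --> X](mul0r (0 : K)); apply: cvgM.
move/cvgrPdist_lt: lim0 => /(_ _ eps0); apply: filterS => n.
rewrite sub0r normrN [`|y - _|]distrC ger0_norm ?addr_ge0 ?mulr_ge0 //.
by apply: le_lt_trans; apply: wu.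
Qed.

Lemma lim_norm_le (K : numFieldType) (V W : normedModType K)
    (u : nat -> V) (x : V) (w : nat -> W) (y : W) (M : K) : 0 <= M ->
  (forall n, `|w n| <= M * `|u n|) ->
  u @ \oo --> x -> w @ \oo --> y -> `|y| <= M * `|x|.
Proof.
move=> M0 wu ux wy.
have Mx : M * `|u n| @[n --> \oo] --> M * `|x|.
  by apply: cvgM; [apply: cvg_cst | apply: cvg_norm].
apply/ler_addgt0Pr => eps eps0.
have e2 : 0 < eps / 2 by rewrite divr_gt0.
have /cvgrPdist_lt/(_ _ e2) ny := wy.
have /cvgrPdist_lt/(_ _ e2) nx := Mx.
have [n [/= yn xn]] := @filter_ex _ \oo _ _ (filterI ny nx).
rewrite -(subrK (w n) y); apply: le_trans (ler_normD _ _) _.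
rewrite [eps]splitr addrA [leLHS]addrC.
apply: lerD; last exact: ltW.
apply: le_trans (wu n) _.
(* The order of [K] may be partial, so the distance bound unfolds only once the difference is known
   to be real. *)
move/ltW: xn; rewrite distrC real_ler_distl; first by case/andP.
by apply: rpredB; apply: ger0_real; rewrite mulr_ge0.
Qed.

(** * Sesquilinearity and continuity of the inner product *)

Section InnerProduct.
Context {R : realType} {A : cstarAlgType R} {H : hilbertModType A}.
Implicit Types (x y z : H) (a b : A) (c : R[i]).

Lemma innerDr x y z : inner x (y + z) = inner x y + inner x z.
Proof. by rewrite inner_star innerDl starD -!inner_star. Qed.

Lemma inner_scalel c x y : inner (c *: x) y = c *: inner x y.
Proof. by rewrite -act_scalar innerZl mulr_algl. Qed.

Lemma inner_scaler c x y : inner x (c *: y) = Num.conj c *: inner x y.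
Proof. by rewrite inner_star inner_scalel starZ -inner_star. Qed.

Lemma star0 : star (0 : A) = 0.
Proof. by rewrite -[X in star X](scale0r (0 : A)) starZ conjC0 scale0r. Qed.

Lemma inner0l x : inner 0 x = 0.
Proof. by rewrite -[X in inner X _](scale0r (0 : H)) inner_scalel scale0r. Qed.

Lemma inner0r x : inner x 0 = 0.
Proof. by rewrite -[X in inner _ X](scale0r (0 : H)) inner_scaler conjC0 scale0r. Qed.

Lemma inner_sumr (I : Type) (r : seq I) (x : H) (y : I -> H) :
  inner x (\sum_(k <- r) y k) = \sum_(k <- r) inner x (y k).
Proof.
by elim/big_rec2: _ => [|k u v _ <-]; rewrite ?inner0r // innerDr.
Qed.

Lemma inner_actr a x y : inner x (act a y) = inner x y * star a.
Proof. by rewrite inner_star innerZl starM -inner_star. Qed.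

Lemma act_scale a c x : act a (c *: x) = c *: act a x.
Proof. by rewrite -!act_scalar -!actA mulr_algl mulr_algr. Qed.

Lemma act_scalel a c x : act (c *: a) x = c *: act a x.
Proof. by rewrite -mulr_algl actA act_scalar. Qed.

Lemma star_scale_real (r : R) a : star (r%:C *: a) = r%:C *: star a.
Proof. by rewrite starZ; congr (_ *: _); apply: conjc_real. Qed.

(** Putting [d = z - x] separates a cross term linear in [d] from the quadratic term [inner d d]. *)
Lemma inner_sub_self x z :
  inner z z - inner x x =
  (inner x (z - x) + inner (z - x) x) + inner (z - x) (z - x).
Proof.
set d := z - x; have -> : z = x + d by rewrite addrC subrK.
by rewrite innerDl !innerDr -!addrA addrC !addrA subrK.
Qed.

(* Substitute for Cauchy-Schwarz: expand [inner (x + t d) (x + t d)] with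
   [t = 1 / |d|]. *)
Lemma inner_cross_le x (d : H) :
  `|inner x d + inner d x| <= `|d| * ((`|x| + 1) ^+ 2 + `|x| ^+ 2 + 1).
Proof.
have [->|d0] := eqVneq d 0.
  by rewrite inner0l inner0r addr0 !normr0 mul0r.
have d_gt0 : 0 < `|d| by rewrite normr_gt0.
set t := `|d|^-1.
have tC : Num.conj t = t by rewrite conj_Creal // realV normr_real.
have td : `|t *: d| = 1 by rewrite normrZ normfV normr_id mulVf ?normr_eq0.
have E : inner x d + inner d x = `|d| *: (inner (x + t *: d) (x + t *: d)
    - inner x x - inner (t *: d) (t *: d)).
  rewrite innerDl !innerDr !addrA.
  have -> : forall p q u v : A, p + q + u + v - p - v = q + u.
    by move=> p q u v; rewrite addrAC addrK -[p + q + u]addrA [p + _]addrC addrK.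
  by rewrite inner_scaler inner_scalel tC -scalerDr scalerA mulfV ?normr_eq0 // scale1r.
rewrite E normrZ normr_id ler_pM2l //.
apply: le_trans (ler_normB _ _) _; rewrite -[X in _ + X]norm_inner td expr1n lerD2r.
apply: le_trans (ler_normB _ _) _; rewrite -!norm_inner lerD2r.
rewrite ler_sqr ?nnegrE ?addr_ge0 //.
by apply: le_trans (ler_normD _ _) _; rewrite td.
Qed.

(** The constant bounding the cross term depends on [x] alone, so the error is at most linear plus
    quadratic in the distance from [u n] to [x]. *)
Lemma inner_self_cvg (u : nat -> H) x :
  u @ \oo --> x -> (fun n => inner (u n) (u n)) @ \oo --> inner x x.
Proof.
apply: (@cvg_quadratic_bound _ _ _ _ _ _ _ ((`|x| + 1) ^+ 2 + `|x| ^+ 2 + 1)).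
  by rewrite !addr_ge0 ?exprn_ge0 ?addr_ge0.
move=> n; rewrite inner_sub_self; apply: le_trans (ler_normD _ _) _.
by rewrite -[`|inner (_ - x) _|]norm_inner lerD2r inner_cross_le.
Qed.

End InnerProduct.

(** * Scaling and subtracting convergent series *)

Lemma cvg_series_scale (K : numFieldType) (V : normedModType K)
    (v : nat -> V) (c : K) (x : V) :
  series v @ \oo --> x -> series (fun k => c *: v k) @ \oo --> c *: x.
Proof.
move=> vx; rewrite (_ : series _ = fun n => c *: series v n).
  exact: cvgZl_tmp.
by apply/funext => n; rewrite /series /= scaler_sumr.
Qed.

Lemma cvg_series_multiplierB (R : realType) (V : normedModType R[i])
    (m1 m2 : nat -> R) (v : nat -> V) (x1 x2 : V) :
  series (fun k => (m1 k)%:C *: v k) @ \oo --> x1 ->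
  series (fun k => (m2 k)%:C *: v k) @ \oo --> x2 ->
  series (fun k => (m1 k - m2 k)%:C *: v k) @ \oo --> x1 - x2.
Proof.
move=> v1 v2; rewrite (_ : series _ = fun n =>
  series (fun k => (m1 k)%:C *: v k) n - series (fun k => (m2 k)%:C *: v k) n).
  exact: cvgB.
apply/funext => n; rewrite /series /= -sumrB; apply: eq_bigr => k _.
by rewrite rmorphB scalerBl.
Qed.

(** * Real multipliers on series of orthogonal vectors *)

Section OrthogonalSeries.
Context {R : realType} {A : cstarAlgType R} {H : hilbertModType A}.
Context (t : nat -> H)
  (t_orth : forall j k, j != k -> inner (t j) (t k) = 0).

(** Pythagoras: in a list without repetition the head is orthogonal to the sum over the tail. Lists
    cover both partial sums and Cauchy blocks. *)
Lemma inner_sum_orthogonal (u : nat -> R[i]) (r : seq nat) : uniq r ->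
  inner (\sum_(k <- r) u k *: t k) (\sum_(k <- r) u k *: t k) =
  \sum_(k <- r) `|u k| ^+ 2 *: inner (t k) (t k).
Proof.
have cross k s : k \notin s -> inner (u k *: t k) (\sum_(j <- s) u j *: t j) = 0.
  move=> ks; rewrite inner_sumr big_seq big1 // => j js.
  rewrite inner_scalel inner_scaler t_orth ?scaler0 //.
  by apply: contraNneq ks => ->.
elim: r => [|k r IH]; first by rewrite !big_nil inner0l.
move=> /= /andP[kr ur]; rewrite !big_cons innerDl !innerDr IH // cross //.
rewrite [inner (\sum_(j <- r) _) _]inner_star cross // star0 addr0 add0r.
congr (_ + _).
by rewrite inner_scalel inner_scaler scalerA normCK.
Qed.

Lemma inner_sum_orthogonal_self (r : seq nat) : uniq r ->
  inner (\sum_(k <- r) t k) (\sum_(k <- r) t k) =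
  \sum_(k <- r) inner (t k) (t k).
Proof.
move=> ur; have := inner_sum_orthogonal (fun=> 1) r ur.
under eq_bigr do rewrite scale1r; move=> ->.
by apply: eq_bigr => k _; rewrite normr1 expr1n scale1r.
Qed.

Lemma norm_sum_unimodular (u : nat -> R[i]) (r : seq nat) : uniq r ->
  (forall k, `|u k| = 1) ->
  `|\sum_(k <- r) u k *: t k| = `|\sum_(k <- r) t k|.
Proof.
move=> ur u1; apply/eqP; rewrite -(@eqrXn2 _ 2) // !norm_inner.
rewrite inner_sum_orthogonal // inner_sum_orthogonal_self //.
by apply/eqP; congr `|_|; apply: eq_bigr => k _; rewrite u1 expr1n scale1r.
Qed.

(* A real number of absolute value at most 1 is the mean of the two conjugate
   unimodular numbers with that real part, and unimodular multipliers preserve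
   the norm. *)
Lemma norm_sum_multiplier (m : nat -> R) (M : R) (r : seq nat) : uniq r ->
  (forall k, `|m k| <= M) ->
  `|\sum_(k <- r) (m k)%:C *: t k| <= M%:C * `|\sum_(k <- r) t k|.
Proof.
move=> ur mM.
(* If [M = 0], every [m k] vanishes; otherwise division by [M] reduces to multipliers in [-1, 1]. *)
have [M0|M_neq0] := eqVneq M 0.
  rewrite big1 ?normr0 ?M0 ?mul0r // => k _.
  by have := mM k; rewrite M0 normr_le0 => /eqP->; rewrite scale0r.
have M_gt0 : 0 < M by rewrite lt_def M_neq0 (le_trans _ (mM 0%N)).
pose s k := m k / M.
have s1 k : s k ^+ 2 <= 1.
  rewrite -real_normK ?num_real // expr_le1 // normrM normfV (gtr0_norm M_gt0).
  by rewrite ler_pdivrMr // mul1r.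
pose u k : R[i] := s k +i* Num.sqrt (1 - s k ^+ 2).
pose v k : R[i] := s k -i* Num.sqrt (1 - s k ^+ 2).
have u1 k : `|u k| = 1.
  by rewrite normc_def /= sqr_sqrtr ?subr_ge0 // addrC subrK sqrtr1.
have v1 k : `|v k| = 1.
  by rewrite normc_def /= sqrrN sqr_sqrtr ?subr_ge0 // addrC subrK sqrtr1.
have -> : \sum_(k <- r) (m k)%:C *: t k =
    (M / 2)%:C *: (\sum_(k <- r) u k *: t k + \sum_(k <- r) v k *: t k).
  rewrite -big_split scaler_sumr; apply: eq_bigr => k _ /=.
  rewrite -scalerDl scalerA; congr (_ *: _).
  rewrite /u /v /s; simpc; congr (_ +i* _).
  by field.
rewrite normrZ; apply: le_trans (ler_wpM2l _ (ler_normD _ _)) _ => //.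
rewrite !norm_sum_unimodular // -mulr2n -[X in _ * X]mulr_natl mulrA ler_wpM2r //.
rewrite ger0_norm; last by rewrite lecR divr_ge0 // ltW.
by rewrite -(rmorph_nat (real_complex R)) -rmorphM divfK ?pnatr_eq0.
Qed.

(** Each Cauchy block of the new series is bounded by a constant times the same block of the
    original one. *)
Lemma is_cvg_series_multiplier (m : nat -> R) (M : R) :
  (forall k, `|m k| <= M) -> cvgn (series t) ->
  cvgn (series (fun k => (m k)%:C *: t k)).
Proof.
move=> mM ct; apply: cauchy_cvg; apply/cauchy_seriesP => eps eps0.
(* [M] may be 0 and [eps] gets divided by the bound, hence [M + 1]. *)
have M1 : 0 < (M + 1)%:C :> R[i].
  by rewrite ltcR ltr_wpDl // (le_trans _ (mM 0%N)).
have /cauchy_cvgP/cauchy_seriesP/(_ (eps / (M + 1)%:C)) := ct.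
move=> /(_ (divr_gt0 eps0 M1)); apply: filterS => -[n p] /= np.
apply: le_lt_trans (norm_sum_multiplier _ (M + 1) _ _ _) _.
- exact: iota_uniq.
- by move=> k; rewrite (le_trans (mM k)) // lerDl.
- by rewrite mulrC -ltr_pdivlMr.
Qed.

Lemma norm_series_multiplier (m : nat -> R) (M : R) (x y : H) :
  (forall k, `|m k| <= M) -> series t @ \oo --> x ->
  series (fun k => (m k)%:C *: t k) @ \oo --> y -> `|y| <= M%:C * `|x|.
Proof.
move=> mM; apply: lim_norm_le => [|n]; first by rewrite lecR (le_trans _ (mM 0%N)).
by apply: norm_sum_multiplier => //; apply: iota_uniq.
Qed.

Lemma cvg_series_inner_self (x : H) : series t @ \oo --> x ->
  series (fun k => inner (t k) (t k)) @ \oo --> inner x x.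
Proof.
move=> /inner_self_cvg; rewrite (_ : series (fun k => _) =
  fun n => inner (series t n) (series t n)) //.
by apply/funext => n; rewrite /series /= inner_sum_orthogonal_self ?iota_uniq.
Qed.

(** Exhibiting the limit as some [inner g g] yields its positivity from [inner_pos], with no appeal
    to closedness of the positive cone. *)
Lemma series_norm2_multiplier (m : nat -> R) (M : R) :
  (forall k, 0 <= m k <= M) -> cvgn (series t) ->
  exists g : H,
    series (fun k => (m k)%:C *: inner (t k) (t k)) @ \oo --> inner g g.
Proof.
move=> mM ct.
have sM k : `|Num.sqrt (m k)| <= Num.sqrt M.
  by have /andP[_ mkM] := mM k; rewrite ger0_norm ?sqrtr_ge0 // ler_wsqrtr.
have := is_cvg_series_multiplier _ _ sM ct => /cvg_ex[g cg]; exists g.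
rewrite (_ : series _ = fun n => inner (series (fun k => (Num.sqrt (m k))%:C *: t k) n)
  (series (fun k => (Num.sqrt (m k))%:C *: t k) n)).
  exact: inner_self_cvg.
apply/funext => n; rewrite /series /= inner_sum_orthogonal ?iota_uniq //.
apply: eq_bigr => k _; congr (_ *: _); have /andP[mk0 _] := mM k.
by rewrite ger0_norm ?lecR ?sqrtr_ge0 // -rmorphXn sqr_sqrtr.
Qed.

End OrthogonalSeries.

(** * Rescaled orthonormal bases: compactness and frame bounds *)

Section OrthonormalMultiplier.
Context {R : realType} {A : cstarAlgType R} {H : hilbertModType A}
  (e : nat -> H) (e_onb : orthonormal_basis e)
  (l : nat -> R) (l_ge0 : forall k, 0 <= l k).
Implicit Types f : H.

Local Notation F := (fun k : nat => (Num.sqrt (l k))%:C *: e k).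
Local Notation coord f := (fun k => act (inner f (e k)) (e k)).

Lemma coord_orth f j k : j != k -> inner (coord f j) (coord f k) = 0.
Proof.
by move=> /negbTE jk; rewrite innerZl inner_actr e_onb.1 jk mul0r mulr0.
Qed.

(** One square root leaves the conjugate-linear slot of [inner], the other comes from the vector
    acted upon; together they give [l k]. *)
Lemma frame_term f k :
  act (inner f (F k)) (F k) = (l k)%:C *: coord f k.
Proof.
rewrite inner_scaler act_scalel act_scale scalerA; congr (_ *: _).
by rewrite conj_Creal ?complex_real // -rmorphM -expr2 sqr_sqrtr.
Qed.

Lemma frame_norm_term f k :
  inner f (F k) * inner (F k) f = (l k)%:C *: inner (coord f k) (coord f k).
Proof.
rewrite -innerZl frame_term inner_scalel !innerZl inner_actr e_onb.1 eqxx mul1r.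
by rewrite -inner_star.
Qed.

Lemma coord_multiplier_compact (m : nat -> R) (K : H -> H) :
  m @ \oo --> (0 : R) ->
  (forall f, series (fun k => (m k)%:C *: coord f k) @ \oo --> K f) ->
  compact_operator K.
Proof.
move=> m0 mK eps eps0.
move/cvgrPdist_le: m0 => /(_ _ eps0)[n _ mn].
exists (fun f => \sum_(i < n) (m i)%:C *: rank_one (e i) (e i) f); split.
  by exists n, (fun i : 'I_n => (m i)%:C), (fun i => e i), (fun i => e i).
(* [m'] is the multiplier of [K] minus its truncation; all its values are at most [eps] in absolute
   value. *)
move=> f; pose m' k := if (k < n)%N then 0 else m k.
apply: (norm_series_multiplier _ (coord_orth f) m' eps f) => [k||].
- rewrite /m'; case: ltnP => [_|nk]; first by rewrite normr0 ltW.
  by have := mn k nk; rewrite sub0r normrN.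
- exact: (e_onb.2 f).
- have KT : series (fun k => (m k)%:C *: coord f k) N
      - \sum_(i < n) (m i)%:C *: coord f i @[N --> \oo]
      --> K f - \sum_(i < n) (m i)%:C *: coord f i.
    by apply: cvgB; [apply: mK | apply: cvg_cst].
  (* Removing the first [n] terms matches the partial sums of [m'] only from [N = n] on. *)
  apply: cvg_trans KT; apply: near_eq_cvg; near=> N.
  have nN : (n <= N)%N by near: N; exact: nbhs_infty_ge.
  rewrite /series /= !(big_cat_nat (leq0n n) nN) /=.
  rewrite -(big_mkord xpredT (fun i => (m i)%:C *: coord f i)).
  rewrite addrAC subrr add0r [X in _ = X + _]big_nat.
  rewrite [X in _ = X + _]big1 ?add0r => [|k /andP[_ kn]].
    by rewrite !big_nat; apply: eq_bigr => k /andP[nk _]; rewrite /m' ltnNge nk.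
  by rewrite /m' kn scale0r.
Unshelve. all: end_near. Qed.

Lemma onb_frame_with_bounds (a b : R) : 0 < a ->
  (forall k, a <= l k <= b) -> frame_with_bounds F a b.
Proof.
move=> a0 lab.
have b0 : 0 < b by have /andP[? ?] := lab 0%N; lra.
split=> // f s.
have ct : cvgn (series (coord f)) by apply/cvg_ex; exists f; apply: e_onb.2.
pose q k := inner (coord f k) (coord f k).
have qf : series q @ \oo --> inner f f.
  exact: (cvg_series_inner_self _ (coord_orth f) _ (e_onb.2 f)).
have sE : s = series (fun k => (l k)%:C *: q k).
  by rewrite /s; congr series; apply/funext => k; rewrite frame_norm_term.
have [g gP] : exists g : H,
    series (fun k => (l k)%:C *: q k) @ \oo --> inner g g.
  by apply: (series_norm2_multiplier _ (coord_orth f) l b) => // k; have := lab k; lra.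
have qc (c : R) := cvg_series_scale _ _ _ c%:C _ qf.
have sl : limn s = inner g g by rewrite sE; apply: cvg_lim gP.
have self x : selfadjoint (inner x x) by rewrite /selfadjoint -inner_star.
have selfs (c : R) x : selfadjoint (c%:C *: inner x x).
  by rewrite /selfadjoint star_scale_real -inner_star.
(* Both frame inequalities are instances: [l - a] and [b - l] take values in [0, b] because 0 < a <=
   l <= b. *)
have diff_pos (m1 m2 : nat -> R) (x1 x2 : A) :
    (forall k, 0 <= m1 k - m2 k <= b) ->
    series (fun k => (m1 k)%:C *: q k) @ \oo --> x1 ->
    series (fun k => (m2 k)%:C *: q k) @ \oo --> x2 -> cstar_pos (x1 - x2).
  move=> m12 q1 q2.
  have [h hP] := series_norm2_multiplier _ (coord_orth f) _ b m12 ct.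
  have q12 := cvg_series_multiplierB _ _ _ _ _ _ _ q1 q2.
  by rewrite (cvg_unique _ q12 hP) //; apply: inner_pos.
rewrite sl; split.
- by rewrite sE; exact: gP.
- split=> //; apply: (diff_pos l (fun=> a)) => // k.
  by have := lab k; lra.
- split=> //; apply: (diff_pos (fun=> b) l) => // k.
  by have := lab k; lra.
Qed.

End OrthonormalMultiplier.

Theorem theorem3p4 (R : realType) (A : cstarAlgType R) (H : hilbertModType A)
  (H_cg : countably_generated H)
  (xi : R) (xi_gt0 : 0 < xi)
  (l : nat -> R) (l_gt : forall k, xi < l k) (l_cvg : l @ \oo --> xi)
  (e : nat -> H) (e_onb : orthonormal_basis e) :
  let F := fun k : nat => (Num.sqrt (l k))%:C *: e k in
  compact_tight_frame F /\ frame_with_bounds F xi (sup (range l)).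
Proof.
(* [sup] bounds the range only if the range is bounded, which convergence of [l] ensures. *)
have l_ub : has_ubound (range l).
  by apply/bounded_fun_has_ubound/cvg_seq_bounded/cvg_ex; exists xi.
have l_ge0 k : 0 <= l k by rewrite ltW // (lt_trans xi_gt0).
have l_sup k : xi <= l k <= sup (range l).
  by rewrite ltW //= ub_le_sup //; exists k.
have F_bounds := onb_frame_with_bounds _ e_onb _ l_ge0 _ _ xi_gt0 l_sup.
move=> F; split => //.
have cf (f : H) : cvgn (series (fun k => act (inner f (e k)) (e k))).
  by apply/cvg_ex; exists f; apply: e_onb.2.
have FE (f : H) : (fun k => act (inner f (F k)) (F k)) =
    (fun k => (l k)%:C *: act (inner f (e k)) (e k)).
  by apply/funext => k; apply: frame_term.
have cS (f : H) : cvgn (series (fun k => act (inner f (F k)) (F k))).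
  rewrite FE.
  apply: (is_cvg_series_multiplier _ (coord_orth _ e_onb f) l (sup (range l))) => // k.
  by rewrite ger0_norm //; have /andP[] := l_sup k.
split=> //; first by exists xi, (sup (range l)).
(* With this choice the decomposition is immediate, and compactness follows since the multiplier
   [l - xi] tends to 0. *)
exists (fun f => frame_operator F f - xi%:C *: f), xi.
split; last by move=> f; rewrite subrK.
apply: (coord_multiplier_compact _ e_onb (fun k => l k - xi)).
  by rewrite -(subrr xi); apply: cvgB => //; apply: cvg_cst.
move=> f; apply: (cvg_series_multiplierB _ _ _ (fun=> xi)).
  by rewrite -FE; apply: cS.
exact: (cvg_series_scale _ _ _ _ _ (e_onb.2 f)).
Qed.
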